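(* Let $\mathcal H$ and $\mathcal G$ be real Hilbert spaces, let $A\colon\mathcal H\to 2^{\mathcal H}$ and $B\colon\mathcal G\to 2^{\mathcal G}$ be maximally monotone, and let $L\colon\mathcal H\to\mathcal G$ be a bounded linear operator. Consider the primal problem: find $x\in\mathcal H$ with $0\in Ax+L^*BLx$, and the dual problem: find $v\in\mathcal G$ with $0\in -LA^{-1}(-L^*v)+B^{-1}v$. Set $Q=(\mathrm{Id}+L^*L)^{-1}$ and assume $\operatorname{zer}(A+L^*BL)\neq\varnothing$. Let $(\lambda_n)_{n\in\mathbb N}$ be a sequence in $\left]0,2\right[$, $(a_n)_{n\in\mathbb N}$ a sequence in $\mathcal H$, $(b_n)_{n\in\mathbb N}$ a sequence in $\mathcal G$, with $\sum_{n}\lambda_n(2-\lambda_n)=+\infty$ and $\sum_n\lambda_n\sqrt{\|a_n\|^2+\|b_n\|^2}<+\infty$. Let $x_0\in\mathcal H$, $v_0\in\mathcal G$, set $y_0=Lx_0$, $u_0=-L^*v_0$, and for every $n\in\mathbb N$: $p_n=J_A(x_n+u_n)+a_n$, $q_n=J_B(y_n+v_n)+b_n$, $r_n=x_n+u_n-p_n$, $s_n=y_n+v_n-q_n$, $t_n=Q(r_n+L^*s_n)$, $w_n=Q(p_n+L^*q_n)$, $x_{n+1}=x_n-\lambda_nt_n$, $y_{n+1}=y_n-\lambda_nLt_n$, $u_{n+1}=u_n+\lambda_n(w_n-p_n)$, $v_{n+1}=v_n+\lambda_n(Lw_n-q_n)$. Then: (i) $x_n-w_n+Q(a_n+L^*b_n)\to0$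 and $y_n-Lw_n+LQ(a_n+L^*b_n)\to0$; (ii) $u_n-r_n+t_n-a_n+Q(a_n+L^*b_n)\to0$ and $v_n-s_n+Lt_n-b_n+LQ(a_n+L^*b_n)\to0$. Moreover, there exist a solution $\overline x$ of the primal problem and a solution $\overline v$ of the dual problem such that (iii) $-L^*\overline v\in A\overline x$ and $\overline v\in BL\overline x$; (iv) $x_n\rightharpoonup\overline x$ and $v_n\rightharpoonup\overline v$ weakly.
   Context: $J_A=(\mathrm{Id}+A)^{-1}$ is the resolvent of $A$; $A^{-1}$ is the set-valued inverse defined via its graph $\{(u,x):u\in Ax\}$; $\operatorname{zer}$ denotes the set of zeros; $\to$ is strong and $\rightharpoonup$ weak convergence. *)

(* Defs.v *)
From HB Require Import structures.
From mathcomp Require Import all_boot all_order all_algebra.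
From mathcomp Require Import all_classical all_reals all_analysis.
Set Implicit Arguments. Unset Strict Implicit. Unset Printing Implicit Defensive.
Import Order.TTheory GRing.Theory Num.Theory.
Import numFieldNormedType.Exports.
Local Open Scope classical_set_scope.
Local Open Scope ring_scope.

Record is_inner_product (R : realType) (H : completeNormedModType R)
    (ip : H -> H -> R) : Prop := {
  ip_sym : forall x y, ip x y = ip y x;
  ip_linl : forall (a : R) (x y z : H), ip (a *: x + y) z = a * ip x z + ip y z;
  ip_norm : forall x, ip x x = `|x| ^+ 2 }.

(* Set-valued operators H -> 2^H are maps H -> set H; u \in A x is A x u. *)
Section Ops.
Variables (R : realType) (H : completeNormedModType R).

Definition monotone_op (ip : H -> H -> R) (A : H -> set H) : Prop :=
  forall x y u v, A x u -> A y v -> 0 <= ip (x - y) (u - v).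

Definition maximally_monotone (ip : H -> H -> R) (A : H -> set H) : Prop :=
  monotone_op ip A /\
  forall B : H -> set H, monotone_op ip B ->
    (forall x u, A x u -> B x u) -> forall x u, B x u -> A x u.

Definition op_add (A B : H -> set H) : H -> set H :=
  fun x => [set z | exists a b, A x a /\ B x b /\ z = a + b].

Definition op_id : H -> set H := fun x => [set x].

Definition op_inv (A : H -> set H) : H -> set H := fun u => [set x | A x u].

Definition resolvent (A : H -> set H) : H -> set H := op_inv (op_add op_id A).

Definition zer (A : H -> set H) : set H := [set x | A x 0].
End Ops.

Definition op_adj_comp (R : realType) (H G : completeNormedModType R)
  (L : H -> G) (Ls : G -> H) (B : G -> set G) : H -> set H :=
  fun x => Ls @` B (L x).

Definition op_dual_part (R : realType) (H G : completeNormedModType R)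
  (L : H -> G) (Ls : G -> H) (A : H -> set H) : G -> set G :=
  fun v => (fun y => - L y) @` op_inv A (- Ls v).

(* Main.v *)
Require Import Defs.
From HB Require Import structures.
From mathcomp Require Import all_boot all_order all_algebra.
From mathcomp Require Import all_classical all_reals all_analysis.
From mathcomp Require Import ring lra.
Import Order.TTheory GRing.Theory Num.Theory.
Import numFieldNormedType.Exports.
Local Open Scope classical_set_scope.
Local Open Scope ring_scope.

(* In the Hilbert sum K = H x G put z_n = (x_n + u_n, y_n + v_n) and let P be the orthogonal
   projection onto the graph of L. Then (x_n, y_n) = P z_n and (u_n, v_n) = z_n - P z_n, and
   the algorithm is the relaxed iteration z_(n+1) = z_n - lam_n (d_n + e_n) with
   d_n = P (z_n - j_n) + (j_n - P j_n), j_n = J_(A x B) z_n and |e_n| = |(a_n, b_n)|.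
   Since z - j belongs to (A x B) j, monotonicity makes z |-> d firmly nonexpansive.
   This gives quasi-Fejer monotonicity, and |d_n| decreases up to a summable error, so that
   d_n -> 0 because sum lam_n (2 - lam_n) diverges; (i) and (ii) are the components of
   P d_n and d_n - P d_n. Maximality shows that a weak limit c of z_n along any ultrafilter
   satisfies c - P c in (A x B) (P c), and Fejer monotonicity makes all these limits equal. *)

Set Implicit Arguments. Unset Strict Implicit.

(** * Real sequences and ultrafilters *)

Lemma partial_sum_le (R : realType) (a e : nat -> R) (S : R) (n : nat) :
  (forall n, a n.+1 <= a n + e n) -> (forall n, \sum_(i < n) e i <= S) ->
  a n <= a 0%N + S.
Proof.
move=> ha hS; suff h : a n <= a 0%N + \sum_(i < n) e i.
  by apply: le_trans h _; rewrite lerD2l.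
elim: n => [|n IH]; first by rewrite big_ord0 addr0.
by rewrite big_ord_recr /= addrA; apply: le_trans (ha n) _; rewrite lerD2r.
Qed.

(** Subtracting the partial sums of [e], which converge, makes [a] nonincreasing and bounded below
    by [- S]. *)
Lemma quasi_nonincreasing_is_cvgn (R : realType) (a e : nat -> R) (S : R) :
  (forall n, 0 <= a n) -> (forall n, 0 <= e n) ->
  (forall n, a n.+1 <= a n + e n) -> (forall n, \sum_(i < n) e i <= S) ->
  cvgn a.
Proof.
move=> a0 e0 ha hS; pose s n := \sum_(i < n) e i.
have sS n : s n.+1 = s n + e n by rewrite /s big_ord_recr.
have cs : cvgn s.
  apply: nondecreasing_is_cvgn.
    by apply/nondecreasing_seqP => n; rewrite sS lerDl.
  by exists S => _ [n _ <-]; exact: hS.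
have cb : cvgn (fun n => a n - s n).
  apply: nonincreasing_is_cvgn.
    by apply/nonincreasing_seqP => n; rewrite sS; have := ha n; lra.
  by exists (- S) => _ [n _ <-]; have := hS n; have := a0 n; rewrite -/(s n); lra.
have -> : a = (fun n => (a n - s n) + s n) by apply/funext => n; rewrite subrK.
exact: is_cvgD.
Qed.

(** If the limit [l] were positive, [a n] would eventually be at least [l / 2], and up to a constant
    the bounded weighted sums would dominate [l / 2] times the unbounded ones. *)
Lemma cvg0_of_weighted_sum_bounded (R : realType) (w a : nat -> R) (S : R) :
  (forall n, 0 <= w n) -> (forall n, 0 <= a n) -> cvgn a ->
  (forall K, exists n, K < \sum_(i < n) w i) ->
  (forall n, \sum_(i < n) w i * a i <= S) ->
  a @ \oo --> (0 : R).
Proof.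
move=> w0 a0 ca wdiv hS; set l := limn a.
have l0 : 0 <= l by apply: limr_ge => //; apply: nearW.
suff l00 : l = 0 by rewrite -l00.
apply/eqP/negP => /negP lneq; have lpos : 0 < l by rewrite lt0r lneq.
have : \forall n \near \oo, l / 2 <= a n.
  by apply: (cvgr_ge _ ca); rewrite -/l; lra.
move=> [N _ hN].
have wa_ge0 i : 0 <= w i * a i by rewrite mulr_ge0.
have bnd n : l / 2 * \sum_(i < n) w i <= l / 2 * \sum_(i < N) w i + S.
  have [nN|Nn] := leqP n N.
    have -> : \sum_(i < N) w i = \sum_(i < n) w i + \sum_(n <= i < N) w i.
      by rewrite -!(big_mkord xpredT) -big_cat_nat.
    have h1 : 0 <= \sum_(n <= i < N) w i by exact: sumr_ge0.
    have h2 := hS 0%N; rewrite big_ord0 in h2.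
    have : 0 <= l / 2 * \sum_(n <= i < N) w i by rewrite mulr_ge0//; lra.
    lra.
  have e1 : \sum_(i < n) w i = \sum_(i < N) w i + \sum_(N <= i < n) w i.
    by rewrite -!(big_mkord xpredT) -big_cat_nat //; exact: ltnW.
  have e2 : \sum_(i < n) w i * a i =
            \sum_(i < N) w i * a i + \sum_(N <= i < n) w i * a i.
    rewrite -(big_mkord xpredT (fun i => w i * a i)).
    by rewrite -(big_mkord xpredT (fun i => w i * a i)) -big_cat_nat //; exact: ltnW.
  have h1 : l / 2 * \sum_(N <= i < n) w i <= \sum_(N <= i < n) w i * a i.
    rewrite mulr_sumr big_nat_cond [leRHS]big_nat_cond.
    apply: ler_sum => i /andP[/andP[Ni _] _].
    by rewrite mulrC ler_wpM2l//; exact: hN.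
  have h2 := hS n; have h3 : 0 <= \sum_(i < N) w i * a i by exact: sumr_ge0.
  rewrite e1 mulrDr; lra.
have [n] := wdiv ((l / 2 * \sum_(i < N) w i + S) / (l / 2)).
rewrite ltr_pdivrMr; last lra.
by have := bnd n; lra.
Qed.

(** If [f n] is not eventually in [B], the indices with [f n] outside [B] generate, together with
    [\oo], a proper filter; an ultrafilter above it contradicts the hypothesis. *)
Lemma cvg_ultra (R : realType) (f : nat -> R) (l : R) :
  (forall U : set_system nat, UltraFilter U -> \oo `<=` U -> f @ U --> l) ->
  f @ \oo --> l.
Proof.
move=> h B Bl; rewrite /= /nbhs /=; apply: contrapT => nB.
pose G : set_system nat := [set X | \forall n \near \oo, ~ B (f n) -> X n].
have FG : ProperFilter G.
  split.
    by move=> G0; apply: nB; near=> n; apply: contrapT; near: n; exact: G0.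
  split.
  - by rewrite /G /=; exists 0%N.
  - by move=> X Y GX GY; rewrite /G /=; near=> n => hn; split; move: hn; near: n.
  - by move=> X Y XY GX; rewrite /G /=; near=> n => hn; apply: XY; move: hn; near: n.
have [U [UU GU]] := ultraFilterLemma FG.
have /(h U UU) fU : \oo `<=` U.
  by move=> X Xoo; apply: GU; rewrite /G /=; near=> n => _; near: n.
have UB : U (f @^-1` B) by exact: fU.
have UnB : U (~` (f @^-1` B)) by apply: GU; exists 0%N.
have PU := @ultra_proper _ _ UU.
by apply: (@filter_not_empty _ U PU); rewrite -(setICr (f @^-1` B)); exact: filterI.
Unshelve. all: by end_near.
Qed.

(** Compactness of the segment provides a cluster point, and an ultrafilter converges to its cluster
    points. *)
Lemma ultra_bounded_cvg (R : realType) (U : set_system nat) (f : nat -> R) (M : R) :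
  UltraFilter U -> (forall n, `|f n| <= M) -> cvg (f @ U).
Proof.
move=> UU fM; have PU := @ultra_proper _ _ UU.
have [|l [_ cl]] := @segment_compact R (- M) M (f @ U) _.
  rewrite /= /fmap /=; have -> : f @^-1` `[- M, M]%classic = setT.
    by apply/seteqP; split => // n _ /=; rewrite in_itv /= -ler_norml.
  exact: filterT.
apply/cvg_ex; exists l => B Bl.
have [//|nB] := in_ultra_setVsetC (f @^-1` B) UU.
by have [y []] := cl (~` B) B nB Bl.
Qed.

(** * Pre-Hilbert spaces *)

(* Stated on a bare [lmodType], since the library's norm on a product is the max norm. *)
Record prehilbert (R : realType) (V : lmodType R) (ip : V -> V -> R) : Prop := {
  pre_sym : forall x y, ip x y = ip y x;
  pre_linl : forall (a : R) x y z, ip (a *: x + y) z = a * ip x z + ip y z;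
  pre_ge0 : forall x, 0 <= ip x x;
  pre_eq0 : forall x, ip x x = 0 -> x = 0 }.

(* The Riesz property: the only form in which completeness is used. *)
Definition representable (R : realType) (V : lmodType R) (ip : V -> V -> R) : Prop :=
  forall f : V -> R, (forall (a : R) x y, f (a *: x + y) = a * f x + f y) ->
    (exists C, forall x, `|f x| <= C * Num.sqrt (ip x x)) ->
    exists c, forall x, f x = ip c x.

Section PreHilbert.
Variables (R : realType) (V : lmodType R) (ip : V -> V -> R).
Hypothesis hip : prehilbert ip.
Local Notation nrm x := (Num.sqrt (ip x x)).

Lemma ip0l x : ip 0 x = 0.
Proof. by have := pre_linl hip (-1) 0 0 x; rewrite scaler0 addr0; lra. Qed.
Lemma ipDl x y z : ip (x + y) z = ip x z + ip y z.
Proof. by have := pre_linl hip 1 x y z; rewrite scale1r mul1r. Qed.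
Lemma ipZl a x z : ip (a *: x) z = a * ip x z.
Proof. by have := pre_linl hip a x 0 z; rewrite addr0 ip0l addr0. Qed.
Lemma ipNl x z : ip (- x) z = - ip x z.
Proof. by rewrite -scaleN1r ipZl mulN1r. Qed.
Lemma ipDr x y z : ip z (x + y) = ip z x + ip z y.
Proof. by rewrite pre_sym // ipDl !(pre_sym hip z). Qed.
Lemma ipZr a x z : ip z (a *: x) = a * ip z x.
Proof. by rewrite pre_sym // ipZl (pre_sym hip z). Qed.
Lemma ipNr x z : ip z (- x) = - ip z x.
Proof. by rewrite pre_sym // ipNl (pre_sym hip z). Qed.
Definition ipE := (ipDl, ipDr, ipNl, ipNr, ipZl, ipZr).

(** Turns vector identities into scalar ones, which [ring] can close. *)
Lemma ip_ext x y : (forall h, ip x h = ip y h) -> x = y.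
Proof.
move=> h; apply/eqP; rewrite -subr_eq0; apply/eqP; apply: (pre_eq0 hip).
by rewrite ipDl ipNl h subrr.
Qed.

Lemma nrm_sqr x : nrm x ^+ 2 = ip x x.
Proof. by rewrite sqr_sqrtr // pre_ge0. Qed.

Lemma nrmZ a x : nrm (a *: x) = `|a| * nrm x.
Proof.
rewrite !ipE mulrA -expr2 sqrtrM ?sqr_ge0 // sqrtr_sqr //.
Qed.

Lemma ip_le_nrm x y : ip x y <= nrm x * nrm y.
Proof.
have hx := nrm_sqr x; have hy := nrm_sqr y.
have x0 : 0 <= nrm x by exact: sqrtr_ge0.
have y0 : 0 <= nrm y by exact: sqrtr_ge0.
move: (nrm x) (nrm y) x0 y0 hx hy => X Y X0 Y0 hx hy.
have [X00|Xneq] := eqVneq X 0.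
  suff -> : x = 0 by rewrite ip0l mulr_ge0.
  by apply: (pre_eq0 hip); rewrite -hx X00 expr0n.
have [Y00|Yneq] := eqVneq Y 0.
  suff -> : y = 0 by rewrite (pre_sym hip) ip0l mulr_ge0.
  by apply: (pre_eq0 hip); rewrite -hy Y00 expr0n.
have XY : 0 < X * Y by rewrite mulr_gt0 // lt0r ?Xneq ?Yneq.
(* This square expands to [2 * (X * Y) * (X * Y - ip x y)]. *)
have := pre_ge0 hip (Y *: x - X *: y); rewrite !ipE -hx -hy (pre_sym hip y x) => h.
by rewrite -(ler_pM2l XY); nra.
Qed.

Lemma normr_ip_le x y : `|ip x y| <= nrm x * nrm y.
Proof.
rewrite ler_norml ip_le_nrm andbT lerNl -ipNl.
by have := ip_le_nrm (- x) y; rewrite [ip (- x) (- x)]ipNl ipNr opprK.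
Qed.

Lemma nrmD x y : nrm (x + y) <= nrm x + nrm y.
Proof.
rewrite -(@ler_pXn2r _ 2) ?nnegrE ?addr_ge0 ?sqrtr_ge0 //.
rewrite nrm_sqr sqrrD !nrm_sqr !ipE (pre_sym hip y x).
by have := ip_le_nrm x y; lra.
Qed.

Lemma nrmN x : nrm (- x) = nrm x.
Proof. by rewrite ipNl ipNr opprK. Qed.

Lemma cvg_ip0 {U : set_system nat} {FU : Filter U} (e f : nat -> V) (M : R) :
  (fun n => ip (e n) (e n)) @ U --> (0 : R) -> (forall n, nrm (f n) <= M) ->
  (fun n => ip (e n) (f n)) @ U --> (0 : R).
Proof.
move=> he hM.
have he' : (fun n => nrm (e n)) @ U --> (0 : R).
  rewrite -[X in _ --> X](@sqrtr0 R).
  by apply: (continuous_cvg _ (@sqrt_continuous R 0)).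
have hb : (fun n => nrm (e n) * M) @ U --> (0 : R).
  by rewrite -(mul0r M); apply: cvgM => //; exact: cvg_cst.
apply: norm_cvg0; apply: squeeze_cvgr hb; last exact: (cvg_cst 0).
apply: nearW => n /=; rewrite normr_ge0 /=.
by apply: le_trans (normr_ip_le _ _) _; rewrite ler_wpM2l // sqrtr_ge0.
Qed.

(** Each scalar sequence is bounded, hence converges along [U]; the limit is linear in [h] and
    bounded by [M * nrm h], so the Riesz property supplies [c]. *)
Lemma weak_ultralimit (U : set_system nat) (z : nat -> V) (M : R) :
  representable ip -> UltraFilter U -> (forall n, nrm (z n) <= M) ->
  exists c, forall h, (fun n => ip (z n) h) @ U --> ip c h.
Proof.
move=> riesz UU zM; have PU := @ultra_proper _ _ UU.
have bd h n : `|ip (z n) h| <= M * nrm h.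
  by apply: le_trans (normr_ip_le _ _) _; rewrite ler_wpM2r // sqrtr_ge0.
have cv h : cvg ((fun n => ip (z n) h) @ U).
  by apply: ultra_bounded_cvg (bd h).
have [||c hc] := riesz (fun h => lim ((fun n => ip (z n) h) @ U)).
- move=> a x y; apply/cvg_lim => //.
  have -> : (fun n => ip (z n) (a *: x + y)) = (fun n => a * ip (z n) x + ip (z n) y).
    by apply/funext => n; rewrite !ipE.
  by apply: cvgD; [apply: cvgM; [exact: cvg_cst|exact: cv]|exact: cv].
- exists M => h; rewrite ler_norml; apply/andP; split.
    by apply: limr_ge; [exact: cv|apply: nearW => n; have := bd h n; rewrite ler_norml => /andP[]].
  by apply: limr_le; [exact: cv|apply: nearW => n; have := bd h n; rewrite ler_norml => /andP[]].
- by exists c => h; rewrite -hc; exact: cv.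
Qed.

(** * Perturbed relaxed iterations of firmly nonexpansive maps *)

Section PerturbedIteration.
Variables (lam : nat -> R) (z d e : nat -> V) (S : R).
Hypothesis hlam : forall n, 0 < lam n < 2.
Hypothesis hz : forall n, z n.+1 = z n - lam n *: (d n + e n).
Hypothesis he : forall n, \sum_(i < n) lam i * nrm (e i) <= S.

(** What firm nonexpansiveness says against a point [f] whose residual vanishes. *)
Definition fejer_target (f : V) := forall n, ip (d n) (d n) <= ip (z n - f) (d n).

Let err_ge0 n : 0 <= lam n * nrm (e n).
Proof. by have /andP[h _] := hlam n; rewrite mulr_ge0 ?sqrtr_ge0 // ltW. Qed.

Let err_leS n : lam n * nrm (e n) <= S.
Proof.
apply: le_trans (he n.+1); rewrite big_ord_recr /= lerDr.
exact: sumr_ge0.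
Qed.

Lemma step_sqr f n : fejer_target f ->
  ip (z n - f - lam n *: d n) (z n - f - lam n *: d n) <=
  ip (z n - f) (z n - f) - lam n * (2 - lam n) * ip (d n) (d n).
Proof.
move=> /(_ n); move: (z n - f) (hlam n) => y /andP[l0 l2] h.
by rewrite !ipE (pre_sym hip (d n) y); nra.
Qed.

Lemma step_nrm f n : fejer_target f -> nrm (z n - f - lam n *: d n) <= nrm (z n - f).
Proof.
move=> /(step_sqr n) h; rewrite ler_sqrt ?pre_ge0 //; apply: le_trans h _.
have /andP[l0 l2] := hlam n.
by rewrite gerBl mulr_ge0 ?pre_ge0 // mulr_ge0 //; lra.
Qed.

Lemma next_nrm f n : nrm (z n.+1 - f) <= nrm (z n - f - lam n *: d n) + lam n * nrm (e n).
Proof.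
have -> : z n.+1 - f = (z n - f - lam n *: d n) + - (lam n *: e n).
  by apply: ip_ext => h; rewrite hz !ipE; ring.
apply: le_trans (nrmD _ _) _; rewrite nrmN nrmZ ger0_norm //.
by have /andP[/ltW] := hlam n.
Qed.

Lemma fejer_step f n : fejer_target f ->
  nrm (z n.+1 - f) <= nrm (z n - f) + lam n * nrm (e n).
Proof. by move=> hf; apply: le_trans (next_nrm _ _) _; rewrite lerD2r step_nrm. Qed.

Lemma fejer_bounded f n : fejer_target f -> nrm (z n - f) <= nrm (z 0%N - f) + S.
Proof.
move=> hf; apply: (partial_sum_le (a := fun n => nrm (z n - f)) _ _ he).
by move=> k; exact: fejer_step.
Qed.

Lemma fejer_is_cvgn f : fejer_target f -> cvgn (fun n => nrm (z n - f)).
Proof.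
move=> hf; apply: quasi_nonincreasing_is_cvgn err_ge0 _ he => n.
  exact: sqrtr_ge0.
exact: fejer_step.
Qed.

Lemma fejer_residual_summable f : fejer_target f ->
  exists K, forall n, \sum_(i < n) lam i * (2 - lam i) * ip (d i) (d i) <= K.
Proof.
move=> hf; pose M := nrm (z 0%N - f) + S.
have S0 : 0 <= S by apply: le_trans (err_leS 0%N); exact: err_ge0.
(* [M] bounds every distance to [f] and [S] every error term, so squaring [next_nrm] costs at most
   [2 * M + S] times the error; the rest telescopes. *)
have step i : lam i * (2 - lam i) * ip (d i) (d i) <=
    nrm (z i - f) ^+ 2 - nrm (z i.+1 - f) ^+ 2 + (2 * M + S) * (lam i * nrm (e i)).
  have h1 := step_sqr i hf; have h2 := step_nrm i hf; have h3 := next_nrm f i.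
  have h4 := fejer_bounded i hf; rewrite -/M in h4.
  have e0 := err_ge0 i; have eS := err_leS i.
  have a0 : 0 <= nrm (z i.+1 - f) by exact: sqrtr_ge0.
  have b0 : 0 <= nrm (z i - f - lam i *: d i) by exact: sqrtr_ge0.
  rewrite -nrm_sqr -[X in _ <= X - _]nrm_sqr in h1.
  move: (nrm (z i.+1 - f)) (nrm (z i - f)) (nrm (z i - f - lam i *: d i))
    (lam i * nrm (e i)) (lam i * (2 - lam i) * ip (d i) (d i)) a0 b0 h1 h2 h3 h4 e0 eS.
  move=> a b c E D a0 b0 h1 h2 h3 h4 e0 eS.
  have : a ^+ 2 <= (c + E) ^+ 2 by rewrite ler_pXn2r // nnegrE addr_ge0.
  have : c * E <= M * E by rewrite ler_wpM2r // (le_trans h2).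
  have : E * E <= S * E by rewrite ler_wpM2r.
  rewrite sqrrD; nra.
exists (nrm (z 0%N - f) ^+ 2 + (2 * M + S) * S) => n.
have M0 : 0 <= M by rewrite addr_ge0 ?sqrtr_ge0.
apply: (@le_trans _ _ (nrm (z 0%N - f) ^+ 2 - nrm (z n - f) ^+ 2 +
   (2 * M + S) * \sum_(i < n) (lam i * nrm (e i)))).
  elim: n => [|n IH]; first by rewrite !big_ord0; lra.
  by rewrite !big_ord_recr /= mulrDr; have := step n; lra.
have h1 : 0 <= nrm (z n - f) ^+ 2 by exact: sqr_ge0.
have h2 : (2 * M + S) * \sum_(i < n) (lam i * nrm (e i)) <= (2 * M + S) * S.
  by rewrite ler_wpM2l //; lra.
lra.
Qed.

Hypothesis hfirm : forall n,
  ip (d n.+1 - d n) (d n.+1 - d n) <= ip (z n.+1 - z n) (d n.+1 - d n).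

(* By firm nonexpansiveness [2 (d n.+1 - d n) - (z n.+1 - z n)] is no longer than
   [z n.+1 - z n], and [2 d n.+1] is the sum of this vector and [(2 - lam n) d n - lam n e n]. *)
Lemma residual_step n : nrm (d n.+1) <= nrm (d n) + lam n * nrm (e n).
Proof.
have /andP[l0 l2] := hlam n.
set w := z n.+1 - z n; have wE : w = - (lam n *: d n) - lam n *: e n.
  by apply: ip_ext => h; rewrite /w hz !ipE; ring.
have nw : nrm w <= lam n * nrm (d n) + lam n * nrm (e n).
  by rewrite wE; apply: le_trans (nrmD _ _) _; rewrite !nrmN !nrmZ gtr0_norm.
have nv : nrm (2 *: (d n.+1 - d n) - w) <= nrm w.
  rewrite ler_sqrt ?pre_ge0 //; have := hfirm n; rewrite -/w.
  clearbody w; move: (d n.+1 - d n) => g h.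
  by rewrite !ipE (pre_sym hip g w); lra.
have E : 2 *: d n.+1 = (2 *: (d n.+1 - d n) - w) + ((2 - lam n) *: d n + - (lam n *: e n)).
  by apply: ip_ext => h; rewrite wE !ipE; ring.
have h : nrm (2 *: d n.+1) <= nrm w + ((2 - lam n) * nrm (d n) + lam n * nrm (e n)).
  rewrite E; apply: le_trans (nrmD _ _) _; apply: lerD => //.
  apply: le_trans (nrmD _ _) _; rewrite nrmN !nrmZ (gtr0_norm l0) ger0_norm //; lra.
move: h; rewrite nrmZ ger0_norm //; nra.
Qed.

(** Bounded weighted sums alone only make the residuals small along a subsequence; [residual_step]
    makes their norms converge, so the limit is zero. *)
Lemma residual_cvg0 f : fejer_target f ->
  (forall K, exists n, K < \sum_(i < n) lam i * (2 - lam i)) ->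
  (fun n => ip (d n) (d n)) @ \oo --> (0 : R).
Proof.
move=> /fejer_residual_summable[K hK] hdiv.
apply: (cvg0_of_weighted_sum_bounded (w := fun i => lam i * (2 - lam i))
  _ _ _ hdiv hK) => [n|n|].
- by have /andP[l0 l2] := hlam n; rewrite /= mulr_ge0 //; lra.
- exact: pre_ge0.
- have c : cvgn (fun n => nrm (d n)).
    by apply: quasi_nonincreasing_is_cvgn err_ge0 residual_step he => n; exact: sqrtr_ge0.
  have -> : (fun n => ip (d n) (d n)) = (fun n => nrm (d n) * nrm (d n)).
    by apply/funext => n; rewrite -expr2 nrm_sqr.
  exact: is_cvgM.
Qed.

(* Two weak ultralimits [c], [c'] in the target set coincide: the distances to both
   converge, hence so does [ip (z n) (c - c')], whose limit is both [ip c (c - c')]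
   and [ip c' (c - c')]. *)
Lemma fejer_weak_cvg f : representable ip -> fejer_target f ->
  (forall (U : set_system nat) c, UltraFilter U -> \oo `<=` U ->
     (forall h, (fun n => ip (z n) h) @ U --> ip c h) -> fejer_target c) ->
  exists2 c, fejer_target c & forall h, (fun n => ip (z n) h) @ \oo --> ip c h.
Proof.
move=> riesz hf hdemi.
have zbd n : nrm (z n) <= nrm (z 0%N - f) + S + nrm f.
  rewrite -[in leLHS](subrK f (z n)); apply: le_trans (nrmD _ _) _.
  by rewrite lerD2r fejer_bounded.
have limP U : UltraFilter U -> \oo `<=` U ->
    exists2 c, fejer_target c & forall h, (fun n => ip (z n) h) @ U --> ip c h.
  by move=> UU oU; have [c hc] := weak_ultralimit riesz UU zbd; exists c => //; exact: (hdemi U).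
(* One ultrafilter picks the candidate; every other one must yield the same point. *)
have [U0 [UU0 oU0]] := ultraFilterLemma (eventually_filter : ProperFilter \oo).
have [c0 c0F hc0] := limP _ UU0 oU0.
exists c0 => // h; apply: cvg_ultra => U UU oU.
have [c cF hc] := limP _ UU oU.
suff -> : c0 = c by exact: hc.
have PU := @ultra_proper _ _ UU; have PU0 := @ultra_proper _ _ UU0.
have cv : cvgn (fun n => ip (z n) (c - c0)).
  have E : (fun n => ip (z n) (c - c0)) = (fun n => 2^-1 *
      (nrm (z n - c0) * nrm (z n - c0) - nrm (z n - c) * nrm (z n - c)
       + (ip c c - ip c0 c0))).
    apply/funext => n; rewrite -!expr2 !nrm_sqr !ipE.
    by rewrite (pre_sym hip c0 (z n)) (pre_sym hip c (z n)); field.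
  rewrite E; apply: is_cvgM; first exact: is_cvg_cst.
  apply: is_cvgD; last exact: is_cvg_cst.
  by apply: is_cvgB; apply: is_cvgM; exact: fejer_is_cvgn.
have e0 : ip c0 (c - c0) = limn (fun n => ip (z n) (c - c0)).
  by apply: (cvg_unique _ (hc0 _)) => //; exact: (cvg_trans (cvg_app _ oU0) cv).
have e1 : ip c (c - c0) = limn (fun n => ip (z n) (c - c0)).
  by apply: (cvg_unique _ (hc _)) => //; exact: (cvg_trans (cvg_app _ oU) cv).
apply/esym/eqP; rewrite -subr_eq0; apply/eqP; apply: (pre_eq0 hip).
by rewrite ipDl ipNl e0 e1 subrr.
Qed.

End PerturbedIteration.
End PreHilbert.

(** * Riesz representation *)

Section InnerProduct.
Variables (R : realType) (H : completeNormedModType R) (ip : H -> H -> R).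
Hypothesis hH : is_inner_product ip.

Lemma inner_product_prehilbert : prehilbert (ip : (H : lmodType R) -> H -> R).
Proof.
split.
- exact: ip_sym hH.
- exact: ip_linl hH.
- by move=> x; rewrite (ip_norm hH) sqr_ge0.
- by move=> x; rewrite (ip_norm hH) => /eqP; rewrite sqrf_eq0 normr_eq0 => /eqP.
Qed.
Let hip := inner_product_prehilbert.

Lemma sqrt_ipE x : Num.sqrt (ip x x) = `|x|.
Proof. by rewrite (ip_norm hH) sqrtr_sqr normr_id. Qed.

(* The representing vector is the minimizer of [ip y y - 2 f y]: by the parallelogram
   identity minimizing sequences are Cauchy. *)
Lemma riesz_representable : representable (ip : (H : lmodType R) -> H -> R).
Proof.
move=> f flin [C hC].
have f0 : f 0 = 0 by have := flin (-1) 0 0; rewrite scaler0 addr0; lra.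
have fD x y : f (x + y) = f x + f y by have := flin 1 x y; rewrite scale1r mul1r.
have fZ k x : f (k *: x) = k * f x by have := flin k x 0; rewrite f0 !addr0.
pose phi y := ip y y - 2 * f y.
have phi_lb y : - C ^+ 2 <= phi y.
  rewrite /phi; have := hC y; rewrite sqrt_ipE (ip_norm hH) => /ler_normlP[_].
  have := sqr_ge0 (`|y| - C); rewrite sqrrB; lra.
have hlb : has_lbound (range phi) by exists (- C ^+ 2) => _ [y _ <-].
have hinf : has_inf (range phi) by split => //; exists (phi 0); exists 0.
set m := inf (range phi).
have phi_m y : m <= phi y by apply: ge_inf => //; exists y.
have [y hy] : exists y : nat -> H, forall n, phi (y n) < m + n.+1%:R^-1.
  suff /choice[y hy] : forall n, exists y, phi y < m + n.+1%:R^-1 by exists y.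
  move=> n; have n0 : 0 < n.+1%:R^-1 :> R by rewrite invr_gt0.
  by have [_ [x _ <-] hx] := inf_adherent n0 hinf; exists x.
have near2 x x' : `|x - x'| ^+ 2 <= 2 * phi x + 2 * phi x' - 4 * m.
  have := phi_m (2^-1 *: (x + x')).
  rewrite /phi -(ip_norm hH) fZ fD !(ipE hip) (ip_sym hH x' x); lra.
have ycvg : cvgn y.
  apply/cauchy_cvgP; apply: cauchy_exP => eps eps0.
  (* [near2] bounds the squared distance from [y N] to [y n] by [2 / (n + 1) + 2 / (N + 1)], at most
     [4 / (N + 1)]. *)
  have [N hN] : exists N : nat, 4 / eps ^+ 2 < N.+1%:R.
    exists (Num.bound (4 / eps ^+ 2)).
    apply: lt_trans (archi_boundP _) _; last by rewrite ltr_nat.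
    by rewrite divr_ge0 // exprn_ge0 // ltW.
  exists (y N); exists N => // n /= Nn; rewrite -ball_normE /=.
  rewrite -(@ltr_pXn2r _ 2) ?nnegrE //; last exact: ltW.
  apply: le_lt_trans (near2 _ _) _.
  have h1 : n.+1%:R^-1 <= N.+1%:R^-1 :> R by rewrite lef_pV2 ?posrE ?ltr0n // ler_nat.
  have h2 : 4 * N.+1%:R^-1 < eps ^+ 2.
    by rewrite ltr_pdivrMr ?ltr0n // mulrC -ltr_pdivrMr // exprn_gt0.
  move: (hy n) (hy N) h1 h2; move: (n.+1%:R^-1) (N.+1%:R^-1) (eps ^+ 2) => i1 i2 e2.
  by lra.
exists (limn y) => h; set c := limn y.
have hc : (fun n => ip (y n) h) @ \oo --> ip c h.
  have e0 : (fun n => ip (y n - c) h) @ \oo --> (0 : R).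
    apply: (cvg_ip0 hip (M := `|h|)) => [|n]; last by rewrite sqrt_ipE.
    have -> : (fun n => ip (y n - c) (y n - c)) = (fun n => `|y n - c| * `|y n - c|).
      by apply/funext => n; rewrite (ip_norm hH) expr2.
    have e : (fun n => `|y n - c|) @ \oo --> (0 : R).
      rewrite -(@normr0 _ H); apply: cvg_norm.
      by rewrite -(subrr c); apply: cvgB => //; exact: cvg_cst.
    by rewrite -(mulr0 0); exact: cvgM.
  have -> : (fun n => ip (y n) h) = (fun n => ip (y n - c) h + ip c h).
    by apply/funext => n; rewrite !(ipE hip) subrK.
  by rewrite -[X in _ --> X]add0r; apply: cvgD => //; exact: cvg_cst.
(* First variation: the right side is [phi (c + t *: h) - phi c], reached as a limit from
   [phi (y n + t *: h) >= m] and [phi (y n) < m + 1 / (n + 1)]. *)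
have quad t : 0 <= 2 * t * (ip c h - f h) + t ^+ 2 * ip h h.
  have cv : (fun n => 2 * t * (ip (y n) h - f h) + t ^+ 2 * ip h h + n.+1%:R^-1) @ \oo -->
      2 * t * (ip c h - f h) + t ^+ 2 * ip h h + 0.
    apply: cvgD; last exact: cvg_harmonic.
    apply: cvgD; last exact: cvg_cst.
    by apply: cvgM; [exact: cvg_cst | apply: cvgB => //; exact: cvg_cst].
  rewrite -[X in 0 <= X]addr0 -(cvg_lim (@Rhausdorff R) cv).
  apply: limr_ge; first by apply/cvg_ex; eexists; exact: cv.
  apply: nearW => n; have := phi_m (y n + t *: h); have := hy n.
  rewrite /phi fD fZ !(ipE hip) (ip_sym hH h (y n)) ?expr2.
  by move: (n.+1%:R^-1) => i; lra.
have k0 : 0 <= ip h h by rewrite (pre_ge0 hip).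
set k := ip h h in quad k0; set g := ip c h - f h in quad.
(* Dividing by [k + 1] rather than by [k], as the minimizer would, covers the case [k = 0]; the
   quadratic is still a negative multiple of [g ^+ 2]. *)
have := quad (- g / (k + 1)).
have -> : 2 * (- g / (k + 1)) * g + (- g / (k + 1)) ^+ 2 * k =
          - (g ^+ 2 * ((k + 2) / (k + 1) ^+ 2)) by field; lra.
rewrite oppr_ge0 pmulr_lle0 => [g2|].
  suff : g = 0 by rewrite /g; lra.
  by apply/eqP; rewrite -sqrf_eq0 eq_le g2 sqr_ge0.
by rewrite divr_gt0 ?exprn_gt0 //; lra.
Qed.

End InnerProduct.

(** * Hilbert sum of two spaces *)

Section Product.
Variables (R : realType) (V W : lmodType R) (ipV : V -> V -> R) (ipW : W -> W -> R).
Hypotheses (hV : prehilbert ipV) (hW : prehilbert ipW).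

Definition prod_ip (p q : (V * W)%type) : R := ipV p.1 q.1 + ipW p.2 q.2.

Lemma prod_prehilbert : prehilbert prod_ip.
Proof.
split=> [x y|a x y z|x|[x y]]; rewrite /prod_ip.
- by rewrite (pre_sym hV) (pre_sym hW).
- by rewrite (pre_linl hV) (pre_linl hW) mulrDr addrACA.
- by rewrite addr_ge0 ?(pre_ge0 hV) ?(pre_ge0 hW).
- move/eqP; rewrite paddr_eq0 ?(pre_ge0 hV) ?(pre_ge0 hW) //= => /andP[/eqP h1 /eqP h2].
  by rewrite (pre_eq0 hV h1) (pre_eq0 hW h2).
Qed.

Lemma prod_representable :
  representable ipV -> representable ipW -> representable prod_ip.
Proof.
move=> rV rW f flin [C hC].
have [||c hc] := rV (fun x => f (x, 0)).
- move=> a x y; rewrite -flin; congr (f (_, _)); by rewrite /= scaler0 addr0.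
- exists C => x; apply: le_trans (hC _) _.
  by rewrite /prod_ip /= (ip0l hW) addr0.
have [||c' hc'] := rW (fun x => f (0, x)).
- move=> a x y; rewrite -flin; congr (f (_, _)); by rewrite /= scaler0 addr0.
- exists C => x; apply: le_trans (hC _) _.
  by rewrite /prod_ip /= (ip0l hV) add0r.
exists (c, c') => -[x y]; rewrite /prod_ip /= -hc -hc'.
have := flin 1 (x, 0) (0, y); rewrite mul1r scale1r => <-.
by congr (f (_, _)); rewrite /= ?addr0 ?add0r.
Qed.

End Product.

(** * Spingarn's method in a pre-Hilbert space *)

Section PartialInverse.
Variables (R : realType) (V : lmodType R) (ip : V -> V -> R).
Hypothesis hip : prehilbert ip.
Variable P : V -> V.
Hypothesis Plin : forall (a : R) x y, P (a *: x + y) = a *: P x + P y.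
Hypothesis Portho : forall x y, ip (P x) (y - P y) = 0.
Variable M : V -> V -> Prop.
Hypothesis Mmon : forall x u y v, M x u -> M y v -> 0 <= ip (x - y) (u - v).
Local Notation nrm x := (Num.sqrt (ip x x)).

Lemma projD x y : P (x + y) = P x + P y.
Proof. by have := Plin 1 x y; rewrite !scale1r. Qed.

Lemma projN x : P (- x) = - P x.
Proof.
have P0 : P 0 = 0.
  by have := Plin (-1) 0 0; rewrite scaler0 addr0 scaleN1r addNr.
by have := Plin (-1) x 0; rewrite !scaleN1r P0 !addr0.
Qed.

(** This lemma and the next two derive from [Portho] that [P] is self-adjoint and idempotent, as an
    orthogonal projection is. *)
Lemma ip_proj x y : ip (P x) (P y) = ip (P x) y.
Proof. by have := Portho x y; rewrite (ipDr hip) (ipNr hip); lra. Qed.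

Lemma proj_sym x y : ip x (P y) = ip (P x) y.
Proof. by rewrite (pre_sym hip) -ip_proj (pre_sym hip) ip_proj. Qed.

Lemma projK x : P (P x) = P x.
Proof.
by apply: (ip_ext hip) => h; rewrite -proj_sym ip_proj.
Qed.

(* If [z - j] belongs to [M j] then this is [z - T z] for the Douglas-Rachford operator
   [T = P (2 J - Id) + Id - J] with [J] the resolvent of [M]. *)
Definition residual (z j : V) : V := P (z - j) + (j - P j).

Lemma residual_proj z j : P (residual z j) = P (z - j).
Proof. by rewrite /residual !(projD, projN) !projK subrr addr0. Qed.

(** With [residual_firm], this makes every [f] such that [M (P f) (f - P f)] a Fejer target. *)
Lemma residual0 z : residual z (P z) = 0.
Proof. by rewrite /residual !(projD, projN) !projK !subrr addr0. Qed.

Lemma residualB z j z' j' :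
  residual z j - residual z' j' = residual (z - z') (j - j').
Proof.
by apply: (ip_ext hip) => h; rewrite /residual !(projD, projN) !(ipE hip); ring.
Qed.

(** The two sides differ by exactly the monotonicity pairing of [j - j'] with
    [(z - j) - (z' - j')]. *)
Lemma residual_firm z j z' j' : M j (z - j) -> M j' (z' - j') ->
  ip (residual z j - residual z' j') (residual z j - residual z' j') <=
  ip (z - z') (residual z j - residual z' j').
Proof.
move=> h h'; have := Mmon h h'; rewrite residualB.
have -> : z - j - (z' - j') = (z - z') - (j - j').
  by apply: (ip_ext hip) => k; rewrite !(ipE hip); ring.
move: (z - z') (j - j') => w i.
rewrite /residual !(projD, projN) !(ipE hip) !ip_proj !proj_sym ?projK.
rewrite (pre_sym hip i w) (pre_sym hip (P i) w) proj_sym.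
by lra.
Qed.

(** Since [x - 2 *: P x] is an isometry ([nrm_reflect]), the distance from [j] to [P z] is the norm
    of the residual. *)
Lemma residual_reflect z j : j - P z = residual z j - 2 *: P (residual z j).
Proof.
rewrite residual_proj.
by apply: (ip_ext hip) => h; rewrite /residual !(projD, projN) !(ipE hip); ring.
Qed.

Lemma nrm_reflect x : ip (x - 2 *: P x) (x - 2 *: P x) = ip x x.
Proof. by rewrite !(ipE hip) !ip_proj !proj_sym; ring. Qed.

(** Weak limits do not pass to products, but when [j n = P (z n) + eps n] is put into the pairing of
    [j n - y] with [z n - j n - v], the product of [P (z n)] with [z n - P (z n)] vanishes by
    orthogonality. Each remaining term is constant, linear in [z n], or carries a factor [eps n],
    which tends to 0 in norm. *)
Lemma residual_demiclosed (U : set_system nat) (z j : nat -> V) (K : R) (c y v : V) :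
  ProperFilter U -> (forall n, M (j n) (z n - j n)) -> (forall n, nrm (z n) <= K) ->
  (fun n => ip (residual (z n) (j n)) (residual (z n) (j n))) @ U --> (0 : R) ->
  (forall h, (fun n => ip (z n) h) @ U --> ip c h) ->
  M y v -> 0 <= ip (P c - y) (c - P c - v).
Proof.
move=> PU hj zK hd hc hyv.
pose eps n := j n - P (z n).
have epsE n : ip (eps n) (eps n) = ip (residual (z n) (j n)) (residual (z n) (j n)).
  by rewrite /eps residual_reflect nrm_reflect.
have eps0 : (fun n => ip (eps n) (eps n)) @ U --> (0 : R).
  by under eq_fun do rewrite epsE.
have cross : (fun n => ip (eps n) (z n - 2 *: P (z n) + (y - v))) @ U --> (0 : R).
  apply: (cvg_ip0 hip (M := K + nrm (y - v))) => // n.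
  by apply: le_trans (nrmD hip _ _) _; rewrite lerD2r nrm_reflect.
have cv : (fun n => ip (z n) (- P v - y + P y) + ip y v
    + ip (eps n) (z n - 2 *: P (z n) + (y - v)) - ip (eps n) (eps n)) @ U -->
    ip c (- P v - y + P y) + ip y v + 0 - 0.
  apply: cvgB => //; apply: cvgD => //; apply: cvgD; [exact: hc|exact: cvg_cst].
have -> : ip (P c - y) (c - P c - v) = ip c (- P v - y + P y) + ip y v + 0 - 0.
  rewrite !(ipE hip) !ip_proj !proj_sym (pre_sym hip y c).
  by rewrite (pre_sym hip (P y) c) proj_sym; ring.
rewrite -(cvg_lim (@Rhausdorff R) cv).
apply: limr_ge; first by apply/cvg_ex; eexists; exact: cv.
apply: nearW => n; have := Mmon (hj n) hyv; rewrite /eps.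
move: (z n) (j n) => w i.
rewrite !(ipE hip) !ip_proj !proj_sym ?projK (pre_sym hip i w) (pre_sym hip (P i) w).
rewrite !proj_sym (pre_sym hip y w) (pre_sym hip y i) (pre_sym hip (P w) i) !proj_sym.
by lra.
Qed.

Hypothesis Mmax : forall x u, (forall y v, M y v -> 0 <= ip (x - y) (u - v)) -> M x u.

Theorem spingarn (lam : nat -> R) (z j e : nat -> V) (S : R) (f : V) :
  representable ip ->
  (forall n, 0 < lam n < 2) ->
  (forall K, exists n, K < \sum_(i < n) lam i * (2 - lam i)) ->
  (forall n, \sum_(i < n) lam i * nrm (e i) <= S) ->
  (forall n, M (j n) (z n - j n)) ->
  (forall n, z n.+1 = z n - lam n *: (residual (z n) (j n) + e n)) ->
  M (P f) (f - P f) ->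
  (fun n => ip (residual (z n) (j n)) (residual (z n) (j n))) @ \oo --> (0 : R) /\
  exists2 c, M (P c) (c - P c) & forall h, (fun n => ip (z n) h) @ \oo --> ip c h.
Proof.
move=> riesz hlam hdiv he hj hz hf; pose d n := residual (z n) (j n).
have target c : M (P c) (c - P c) -> fejer_target ip z d c.
  by move=> hc n; have := residual_firm (hj n) hc; rewrite residual0 subr0.
have d0 : (fun n => ip (d n) (d n)) @ \oo --> (0 : R).
  by apply: (residual_cvg0 hip hlam hz he _ (target _ hf) hdiv) => n; exact: residual_firm.
split=> //.
have zbd n : nrm (z n) <= nrm (z 0%N - f) + S + nrm f.
  rewrite -[in leLHS](subrK f (z n)); apply: le_trans (nrmD hip _ _) _.
  by rewrite lerD2r; exact: (fejer_bounded hip hlam hz he n (target _ hf)).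
have demi (U : set_system nat) c : UltraFilter U -> \oo `<=` U ->
    (forall h, (fun n => ip (z n) h) @ U --> ip c h) -> M (P c) (c - P c).
  move=> UU oU hc; have PU := @ultra_proper _ _ UU.
  apply: Mmax => y v; apply: (residual_demiclosed PU hj zbd _ hc).
  exact: (cvg_trans (cvg_app _ oU) d0).
have [|c _ hc] := fejer_weak_cvg hip hlam hz he riesz (target _ hf).
  by move=> U c UU oU /(demi U c UU oU)/target.
exists c => //.
(* [fejer_weak_cvg] returns only a Fejer target; the inclusion comes from demiclosedness along one
   ultrafilter. *)
have [U [UU oU]] := ultraFilterLemma (eventually_filter : ProperFilter \oo).
by apply: (demi U c UU oU) => h; exact: (cvg_trans (cvg_app _ oU) (hc h)).
Qed.

End PartialInverse.

(** * Primal-dual splitting *)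

Section Operators.
Variables (R : realType) (H G : completeNormedModType R).
Variables (ipH : H -> H -> R) (ipG : G -> G -> R).
Hypotheses (hH : is_inner_product ipH) (hG : is_inner_product ipG).
Let hpH := inner_product_prehilbert hH.
Let hpG := inner_product_prehilbert hG.

(** The graph of [A] with the pair [(x, u)] added is still monotone, so maximality puts the pair in
    [A]. *)
Lemma maximally_monotoneP (A : H -> set H) x u : maximally_monotone ipH A ->
  (forall y v, A y v -> 0 <= ipH (x - y) (u - v)) -> A x u.
Proof.
move=> [Amon Amax] hxu.
apply: (Amax (fun y => [set v | A y v \/ (y = x /\ v = u)])); last by right.
- move=> y y' v v' [h|[-> ->]] [h'|[-> ->]].
  + exact: Amon.
  + have := hxu _ _ h; rewrite -(opprB y x) -(opprB v u).
    by rewrite (ipNl hpH) (ipNr hpH) opprK.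
  + exact: hxu.
  + by rewrite subrr (ip0l hpH).
- by move=> y v h; left.
Qed.

End Operators.

Definition prod_op (R : realType) (H G : completeNormedModType R)
    (A : H -> set H) (B : G -> set G) (j u : (H * G)%type) : Prop :=
  A j.1 u.1 /\ B j.2 u.2.

(** If [(x1, u1)] were not in [A], some pair of [A] would have a negative pairing with it. All
    pairings of [(x2, u2)] with [B] would then be positive, so [(x2, u2)] lies in [B]; taken as a
    test pair, it leaves only the negative term. *)
Lemma prod_op_maximal (R : realType) (H G : completeNormedModType R)
    (ipH : H -> H -> R) (ipG : G -> G -> R)
    (hH : is_inner_product ipH) (hG : is_inner_product ipG)
    (A : H -> set H) (B : G -> set G)
    (hA : maximally_monotone ipH A) (hB : maximally_monotone ipG B)
    (x u : (H * G)%type) :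
  (forall y v, prod_op A B y v -> 0 <= prod_ip ipH ipG (x - y) (u - v)) ->
  prod_op A B x u.
Proof.
have hpH := inner_product_prehilbert hH; have hpG := inner_product_prehilbert hG.
case: x u => [x1 x2] [u1 u2]; rewrite /prod_op /prod_ip /= => h.
have hAB y1 v1 y2 v2 : A y1 v1 -> B y2 v2 ->
    0 <= ipH (x1 - y1) (u1 - v1) + ipG (x2 - y2) (u2 - v2).
  by move=> h1 h2; exact: (h (y1, y2) (v1, v2)).
suff hAx : A x1 u1.
  split=> //; apply: (maximally_monotoneP hG hB) => y v hy.
  by have := hAB _ _ _ _ hAx hy; rewrite subrr (ip0l hpH) add0r.
apply: contrapT => nA; have [] := nA; apply: (maximally_monotoneP hH hA) => y v hy.
rewrite leNgt; apply/negP => neg.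
have hBx : B x2 u2.
  apply: (maximally_monotoneP hG hB) => y' v' hy'.
  by have := hAB _ _ _ _ hy hy'; lra.
by have := hAB _ _ _ _ hy hBx; rewrite subrr (ip0l hpG); lra.
Qed.

Lemma cvg0_sqr_le (R : realType) (H : completeNormedModType R) (f : nat -> H)
    (g : nat -> R) :
  (forall n, `|f n| ^+ 2 <= g n) -> g @ \oo --> (0 : R) -> f @ \oo --> (0 : H).
Proof.
move=> fg g0; apply: norm_cvg0.
have sg : (fun n => Num.sqrt (g n)) @ \oo --> (0 : R).
  rewrite -[X in _ --> X](@sqrtr0 R).
  by apply: (continuous_cvg _ (@sqrt_continuous R 0)).
apply: squeeze_cvgr sg; last exact: (cvg_cst 0).
apply: nearW => n /=; rewrite normr_ge0 /=.
by rewrite -[`|f n|]normr_id -sqrtr_sqr ler_sqrt // (le_trans _ (fg n)) // sqr_ge0.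
Qed.

Lemma nneseries_lt_pinfty_bounded (R : realType) (a : nat -> R) :
  (forall n, 0 <= a n) -> (\sum_(n <oo) (a n)%:E < +oo)%E ->
  exists S, forall n, \sum_(i < n) a i <= S.
Proof.
move=> a0 hlt; have ge n : ((\sum_(i < n) a i)%:E <= \sum_(n <oo) (a n)%:E)%E.
  rewrite -sumEFin -(big_mkord xpredT (fun i => (a i)%:E)).
  by apply: nneseries_lim_ge => k _ _; rewrite lee_fin.
move: hlt ge; case: (limn _) => [S _ ge|//|_ ge].
- by exists S => n; rewrite -lee_fin.
- by have := ge 0%N.
Qed.

Lemma nneseries_pinfty_unbounded (R : realType) (a : nat -> R) :
  (forall n, 0 <= a n) -> (\sum_(n <oo) (a n)%:E = +oo)%E ->
  forall K, exists n, K < \sum_(i < n) a i.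
Proof.
move=> a0 hinf K; apply: contrapT => /forallNP hK.
suff : (\sum_(n <oo) (a n)%:E <= K%:E)%E by rewrite hinf.
apply: lime_le; first by apply: is_cvg_nneseries => k _ _; rewrite lee_fin.
apply: nearW => n; rewrite big_mkord sumEFin lee_fin.
by rewrite leNgt; apply/negP; exact: hK.
Qed.

(** * Orthogonal projection onto the graph of [L] *)

Section GraphProjection.
Variables (R : realType) (H G : completeNormedModType R).
Variables (ipH : H -> H -> R) (ipG : G -> G -> R).
Hypotheses (hH : is_inner_product ipH) (hG : is_inner_product ipG).
Variables (L : {linear H -> G}) (Ls : G -> H) (Q : H -> H).
Hypothesis hLs : forall x v, ipG (L x) v = ipH x (Ls v).
Hypothesis hQ : forall z, Q z + Ls (L (Q z)) = z.
Let hpH := inner_product_prehilbert hH.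
Let hpG := inner_product_prehilbert hG.

Lemma adjoint_linear k x y : Ls (k *: x + y) = k *: Ls x + Ls y.
Proof.
apply: (ip_ext hpH) => h.
by rewrite !(ipE hpH) !(ip_sym hH _ h) -!hLs !(ipE hpG).
Qed.

(** Pairing the difference with [x - y] gives the sum of the squared norms of [x - y] and
    [L (x - y)]. Injectivity turns [Q], a right inverse by [hQ], into a two-sided inverse and makes
    it linear. *)
Lemma Id_adj_comp_inj x y : x + Ls (L x) = y + Ls (L y) -> x = y.
Proof.
move=> h; apply/eqP; rewrite -subr_eq0; apply/eqP; apply: (pre_eq0 hpH).
have e : (x - y) + Ls (L (x - y)) = 0.
  have -> : Ls (L (x - y)) = Ls (L x) - Ls (L y).
    by rewrite addrC -scaleN1r linearP adjoint_linear scaleN1r addrC.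
  by rewrite addrACA -opprD h subrr.
have : ipH (x - y) (x - y + Ls (L (x - y))) = 0.
  by rewrite e (ip_sym hH) (ip0l hpH).
rewrite (ipDr hpH) -hLs => /eqP.
by rewrite paddr_eq0 ?(pre_ge0 hpH) ?(pre_ge0 hpG) // => /andP[/eqP].
Qed.

Lemma resolvent_Id_adj_comp x : Q (x + Ls (L x)) = x.
Proof. by apply: Id_adj_comp_inj; rewrite hQ. Qed.

Lemma resolvent_linear k x y : Q (k *: x + y) = k *: Q x + Q y.
Proof.
apply: Id_adj_comp_inj; rewrite hQ linearP adjoint_linear addrACA -scalerDr.
by rewrite !hQ.
Qed.

(** The nearest point [(q, L q)] of the graph to [z] solves the normal equation
    [q + Ls (L q) = z.1 + Ls z.2]. *)
Definition graph_proj (z : (H * G)%type) : (H * G)%type :=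
  (Q (z.1 + Ls z.2), L (Q (z.1 + Ls z.2))).

Lemma graph_proj_linear k x y :
  graph_proj (k *: x + y) = k *: graph_proj x + graph_proj y.
Proof.
rewrite /graph_proj /= adjoint_linear addrACA -scalerDr resolvent_linear.
by rewrite linearP.
Qed.

Lemma graph_proj_ortho x y :
  prod_ip ipH ipG (graph_proj x) (y - graph_proj y) = 0.
Proof.
rewrite /prod_ip /= hLs -(ipDr hpH).
set q := Q (y.1 + _).
have -> : y.1 - q + Ls (y.2 - L q) = 0.
  have -> : Ls (y.2 - L q) = Ls y.2 - Ls (L q).
    by rewrite addrC -scaleN1r adjoint_linear scaleN1r addrC.
  by rewrite addrACA -opprD hQ subrr.
by rewrite (ip_sym hH) (ip0l hpH).
Qed.

(** The argument is [(x, L x)] plus [(- Ls v, v)], which is orthogonal to the graph. *)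
Lemma graph_projE x v : graph_proj (x - Ls v, L x + v) = (x, L x).
Proof.
rewrite /graph_proj /=.
have -> : x - Ls v + Ls (L x + v) = x + Ls (L x).
  have -> : Ls (L x + v) = Ls (L x) + Ls v.
    by have := adjoint_linear 1 (L x) v; rewrite !scale1r.
  by rewrite addrACA addNr addr0.
by rewrite resolvent_Id_adj_comp.
Qed.

End GraphProjection.

(** * The primal-dual algorithm in the Hilbert sum *)

Unset Implicit Arguments. Set Strict Implicit.

Theorem theorem3p2 (R : realType) (H G : completeNormedModType R)
  (ipH : H -> H -> R) (ipG : G -> G -> R)
  (hH : is_inner_product ipH) (hG : is_inner_product ipG)
  (A : H -> set H) (B : G -> set G)
  (hA : maximally_monotone ipH A) (hB : maximally_monotone ipG B)
  (L : {linear H -> G}) (hLb : exists C : R, forall x, `|L x| <= C * `|x|)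
  (Ls : G -> H) (hLs : forall x v, ipG (L x) v = ipH x (Ls v))
  (Q : H -> H) (hQ : forall z, Q z + Ls (L (Q z)) = z)
  (hzer : zer (op_add A (op_adj_comp L Ls B)) !=set0)
  (lam : nat -> R) (hlam : forall n, 0 < lam n < 2)
  (a : nat -> H) (b : nat -> G)
  (hsum1 : (\sum_(n <oo) ((lam n * (2 - lam n))%:E) = +oo)%E)
  (hsum2 : (\sum_(n <oo) ((lam n * Num.sqrt (`|a n| ^+ 2 + `|b n| ^+ 2))%:E) < +oo)%E)
  (x u p r t w : nat -> H) (y v q s : nat -> G)
  (hy0 : y 0%N = L (x 0%N)) (hu0 : u 0%N = - Ls (v 0%N))
  (hp : forall n, resolvent A (x n + u n) (p n - a n))
  (hq : forall n, resolvent B (y n + v n) (q n - b n))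
  (hr : forall n, r n = x n + u n - p n)
  (hs : forall n, s n = y n + v n - q n)
  (ht : forall n, t n = Q (r n + Ls (s n)))
  (hw : forall n, w n = Q (p n + Ls (q n)))
  (hx1 : forall n, x n.+1 = x n - lam n *: t n)
  (hy1 : forall n, y n.+1 = y n - lam n *: L (t n))
  (hu1 : forall n, u n.+1 = u n + lam n *: (w n - p n))
  (hv1 : forall n, v n.+1 = v n + lam n *: (L (w n) - q n)) :
  (* (i) *)
  ((fun n => x n - w n + Q (a n + Ls (b n))) @ \oo --> (0 : H)) /\
  ((fun n => y n - L (w n) + L (Q (a n + Ls (b n)))) @ \oo --> (0 : G)) /\
  (* (ii) *)
  ((fun n => u n - r n + t n - a n + Q (a n + Ls (b n))) @ \oo --> (0 : H)) /\
  ((fun n => v n - s n + L (t n) - b n + L (Q (a n + Ls (b n)))) @ \oo --> (0 : G)) /\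
  exists (xbar : H) (vbar : G),
    zer (op_add A (op_adj_comp L Ls B)) xbar /\
    zer (op_add (op_dual_part L Ls A) (op_inv B)) vbar /\
    (* (iii) *)
    A xbar (- Ls vbar) /\ B (L xbar) vbar /\
    (* (iv) weak convergence *)
    (forall z : H, (fun n => ipH (x n) z) @ \oo --> ipH xbar z) /\
    (forall z : G, (fun n => ipG (v n) z) @ \oo --> ipG vbar z).
Proof.
have hpH := inner_product_prehilbert hH; have hpG := inner_product_prehilbert hG.
have hpK := prod_prehilbert hpH hpG.
have riesz := prod_representable hpH hpG (riesz_representable hH) (riesz_representable hG).
set ipK := prod_ip ipH ipG in hpK riesz.
pose P := graph_proj L Ls Q.
have Plin (k : R) (y1 y2 : (H * G)%type) : P (k *: y1 + y2) = k *: P y1 + P y2.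
  exact (graph_proj_linear hH hG hLs hQ k y1 y2).
have Portho y1 y2 : ipK (P y1) (y2 - P y2) = 0.
  exact (graph_proj_ortho hH hG hLs hQ y1 y2).
pose M := prod_op A B.
have Mmon y1 u1 y2 u2 : M y1 u1 -> M y2 u2 -> 0 <= ipK (y1 - y2) (u1 - u2).
  by move=> [A1 B1] [A2 B2]; apply: addr_ge0; [exact: hA.1|exact: hB.1].
have Mmax := @prod_op_maximal _ _ _ _ _ hH hG _ _ hA hB.
have LsD y1 y2 : Ls (y1 + y2) = Ls y1 + Ls y2.
  by have := adjoint_linear hH hG hLs 1 y1 y2; rewrite !scale1r.
have LsZ k y1 : Ls (k *: y1) = k *: Ls y1.
  have Ls0 : Ls 0 = 0 by apply/(addIr (Ls 0)); rewrite -LsD !addr0 add0r.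
  by have := adjoint_linear hH hG hLs k y1 0; rewrite Ls0 !addr0.
(* The updates keep [(x n, y n)] in the graph of [L] and, next, [(u n, v n)] in its orthogonal
   complement. *)
have hyL n : y n = L (x n).
  by elim: n => [//|n IH]; rewrite hy1 hx1 IH linearB [L (_ *: _)]linearZ.
have huL n : u n = - Ls (v n).
  elim: n => [//|n IH]; rewrite hu1 hv1 IH LsD LsZ opprD -scalerN; congr (_ + _ *: _).
  have E : w n + Ls (L (w n)) = p n + Ls (q n) by rewrite hw hQ.
  have -> : Ls (L (w n) - q n) = Ls (L (w n)) - Ls (q n).
    by rewrite LsD -scaleN1r LsZ scaleN1r.
  apply: (ip_ext hpH) => h; have := congr1 (fun k => ipH k h) E.
  by rewrite /= !(ipE hpH); lra.
pose z n : (H * G)%type := (x n + u n, y n + v n).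
pose al n : (H * G)%type := (a n, b n).
pose pi n : (H * G)%type := (p n, q n).
pose j n := pi n - al n.
(* The updates use the inexact [pi n], whereas [residual] needs the exact resolvent [j n]; the
   exchange costs this reflection of [al n], which has the norm of [al n]. *)
pose e n := al n - 2 *: P (al n).
have Pz n : P (z n) = (x n, y n).
  by rewrite /z huL hyL; exact (graph_projE hH hG hLs hQ (x n) (v n)).
have Ppi n : P (pi n) = (w n, L (w n)) by rewrite /P /graph_proj /= -hw.
have Pzpi n : P (z n - pi n) = (t n, L (t n)).
  by rewrite /P /graph_proj /= -hr -hs -ht.
have de n : residual P (z n) (j n) + e n = P (z n - pi n) + (pi n - P (pi n)).
  apply: (ip_ext hpK) => h; rewrite /residual /e /j.
  by rewrite !(projD Plin, projN Plin) !(ipE hpK); ring.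
have hz n : z n.+1 = z n - lam n *: (residual P (z n) (j n) + e n).
  rewrite de Pzpi Ppi; congr (_, _) => /=.
    rewrite hx1 hu1; apply: (ip_ext hpH) => h; rewrite !(ipE hpH); ring.
  rewrite hy1 hv1; apply: (ip_ext hpG) => h; rewrite !(ipE hpG); ring.
have hj n : M (j n) (z n - j n).
  split => /=.
    by have [c [d [<- [Ad ->]]]] := hp n; rewrite addrAC subrr add0r.
  by have [c [d [<- [Bd ->]]]] := hq n; rewrite addrAC subrr add0r.
have en n : Num.sqrt (ipK (e n) (e n)) = Num.sqrt (`|a n| ^+ 2 + `|b n| ^+ 2).
  rewrite /e (nrm_reflect hpK Portho) /ipK /prod_ip /=.
  by rewrite (ip_norm hH) (ip_norm hG).
have [S hS] : exists S, forall n, \sum_(i < n) lam i * Num.sqrt (ipK (e i) (e i)) <= S.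
  under eq_exists do under eq_forall do under eq_bigr do rewrite en.
  apply: nneseries_lt_pinfty_bounded hsum2 => n.
  by have /andP[/ltW l0 _] := hlam n; rewrite mulr_ge0 ?sqrtr_ge0.
have hdiv K : exists n, K < \sum_(i < n) lam i * (2 - lam i).
  apply: nneseries_pinfty_unbounded hsum1 K => n.
  by have /andP[l0 l2] := hlam n; rewrite mulr_ge0 //; lra.
have [xs [a0 [b0 [Aa [[c Bc <-] E0]]]]] := hzer.
have [f hf] : exists f, M (P f) (f - P f).
  (* Since [- Ls c] is in [A xs] and [c] in [B (L xs)], take the point with projection [(xs, L xs)]
     and remainder [(- Ls c, c)]. *)
  exists (xs - Ls c, L xs + c); rewrite /P (graph_projE hH hG hLs hQ); split=> /=.
    by rewrite addrAC subrr add0r; have -> : - Ls c = a0 by apply/eqP; rewrite eq_sym -addr_eq0 -E0.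
  by rewrite addrAC subrr add0r.
have [d0 [zb Mzb hzb]] := spingarn hpK Plin Portho Mmon Mmax riesz hlam hdiv hS hj hz hf.
(* The two summands of the residual are orthogonal, so both tend to 0; [E1] and [E2] match their
   components with (i) and (ii). *)
have Pd0 : (fun n => ipK (P (z n - j n)) (P (z n - j n))) @ \oo --> (0 : R) /\
           (fun n => ipK (j n - P (j n)) (j n - P (j n))) @ \oo --> (0 : R).
  have E n : ipK (residual P (z n) (j n)) (residual P (z n) (j n)) =
      ipK (P (z n - j n)) (P (z n - j n)) + ipK (j n - P (j n)) (j n - P (j n)).
    rewrite /residual; have := Portho (z n - j n) (j n).
    move: (P (z n - j n)) (j n - P (j n)) => k1 k2 o.
    by rewrite !(ipE hpK) (pre_sym hpK k2 k1) o; ring.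
  split; apply: squeeze_cvgr (cvg_cst 0) d0; apply: nearW => n /=.
    by rewrite E (pre_ge0 hpK) lerDl (pre_ge0 hpK).
  by rewrite E (pre_ge0 hpK) lerDr (pre_ge0 hpK).
have fstle (k : (H * G)%type) : `|k.1| ^+ 2 <= ipK k k.
  by rewrite /ipK /prod_ip (ip_norm hH) (ip_norm hG) lerDl sqr_ge0.
have sndle (k : (H * G)%type) : `|k.2| ^+ 2 <= ipK k k.
  by rewrite /ipK /prod_ip (ip_norm hH) (ip_norm hG) lerDr sqr_ge0.
have E1 n : P (z n - j n) = (x n - w n + Q (a n + Ls (b n)),
                             y n - L (w n) + L (Q (a n + Ls (b n)))).
  by rewrite /j !(projD Plin, projN Plin) Pz Ppi opprB addrA addrAC.
have E2 n : j n - P (j n) = (u n - r n + t n - a n + Q (a n + Ls (b n)),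
                             v n - s n + L (t n) - b n + L (Q (a n + Ls (b n)))).
  have [tE LtE] : t n = x n - w n /\ L (t n) = y n - L (w n).
    by have := Pzpi n; rewrite (projD Plin) (projN Plin) Pz Ppi => -[<- <-].
  rewrite /j !(projD Plin, projN Plin) Ppi; congr (_, _) => /=.
    rewrite tE hr; apply: (ip_ext hpH) => h; rewrite !(ipE hpH); ring.
  rewrite LtE hs; apply: (ip_ext hpG) => h; rewrite !(ipE hpG); ring.
split; [|split; [|split; [|split]]].
- by apply: cvg0_sqr_le Pd0.1 => n; have := fstle (P (z n - j n)); rewrite {1}E1.
- by apply: cvg0_sqr_le Pd0.1 => n; have := sndle (P (z n - j n)); rewrite {1}E1.
- by apply: cvg0_sqr_le Pd0.2 => n; have := fstle (j n - P (j n)); rewrite {1}E2.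
- by apply: cvg0_sqr_le Pd0.2 => n; have := sndle (j n - P (j n)); rewrite {1}E2.
have hPzb : (P zb).2 = L (P zb).1 by [].
set xb := (P zb).1 in hPzb; set vb := zb.2 - (P zb).2.
(* [zb - P zb] is orthogonal to the graph, hence of the form [(- Ls vb, vb)]. *)
have hub : zb.1 - xb = - Ls vb.
  have := hQ (zb.1 + Ls zb.2); rewrite -/xb => E.
  have -> : Ls vb = Ls zb.2 - Ls (L xb) by rewrite /vb hPzb LsD -scaleN1r LsZ scaleN1r.
  by apply/eqP; rewrite opprB subr_eq addrAC eq_sym subr_eq addrC E.
have [Axb Bxb] : A xb (- Ls vb) /\ B (L xb) vb.
  by move: Mzb => [h1 h2]; split; [rewrite -hub|rewrite -hPzb].
exists xb, vb; split; [|split; [|split; [|split; [|split]]]] => //.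
- exists (- Ls vb), (Ls vb); split=> //; split; first by exists vb.
  by rewrite addNr.
- exists (- L xb), (L xb); split; first by exists xb.
  by split=> //; rewrite addNr.
(* Self-adjointness turns this into the pairing of [P (z n)], that is [(x n, y n)], with
   [(h, 0)]. *)
- move=> h; have : (fun n => ipK (z n) (P (h, 0))) @ \oo --> ipK zb (P (h, 0)) by exact: hzb.
  rewrite (proj_sym hpK Portho).
  under eq_fun do rewrite (proj_sym hpK Portho) Pz /ipK /prod_ip /= (ip_sym hG) (ip0l hpG) addr0.
  by rewrite /ipK /prod_ip /= (ip_sym hG _ 0) (ip0l hpG) addr0.
(* Likewise the complementary projection extracts [v n] as the second component of
   [z n - P (z n)]. *)
- move=> h; have : (fun n => ipK (z n) ((0, h) - P (0, h))) @ \oo -->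
      ipK zb ((0, h) - P (0, h)) by exact: hzb.
  have E k : ipK k ((0, h) - P (0, h)) = ipG (k.2 - (P k).2) h.
    rewrite (ipDr hpK) (ipNr hpK) (proj_sym hpK Portho) -(ipNl hpK) -(ipDl hpK).
    by rewrite /ipK /prod_ip /= (ip_sym hH _ 0) (ip0l hpH) add0r.
  rewrite E; under eq_fun do rewrite E Pz /= addrAC subrr add0r.
  exact.
Qed.
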